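(* Let $n\ge1$ and let $\mathcal B_n$ be the set of $\Gamma$-diagrams of type $(B_n,n)$ of maximal shape $Q$ whose bottom box $(n,1)$ contains a $+$. Then $\mathcal B_n$ is in bijection with the set of preference functions of length $n$. Consequently, the number of $\Gamma$-diagrams of type $(B_n,n)$ of maximal shape equals twice the number of preference functions of length $n$.
   Context: $W$: Weyl group of type $B_n$, simple reflections $s_1,\dots,s_n$ ($s_is_{i+1}$ of order 3 for $i\le n-2$, $s_{n-1}s_n$ of order 4, others commute), Bruhat order $<$. $Q$: boxes $(r,c)$, $1\le r\le n$ (rows top to bottom), $1\le c\le n-r+1$, labeled $s_{r+c-1}$; order = transitive closure of $(r,c)\lessdot(r,c+1)$, $(r,c)\lessdot(r-1,c)$. An $\oplus$-diagram of shape $Q$ is $D:Q\to\{0,+\}$; for a linear extension $b_1,\dots,b_m$ of $Q$, $s_{i_t}:=s_{b_{m+1-t}}$, $t_t=s_{i_t}$ if $D(b_{m+1-t})=0$ and $1$ otherwise, $v_{(0)}=1$, $v_{(k)}=t_1\cdots t_k$; $D$ is a $\Gamma$-diagram if $v_{(k-1)}<v_{(k-1)}s_{i_k}$ for all $k$. A preference function of length $n$ is a word $p_1\cdots p_n$ of positive integers such that $\{p_1,\dots,p_n\}=\{1,\dots,k\}$ for some $k\le n$. *)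

(* Defs.v *)
From HB Require Import structures.
From mathcomp Require Import all_boot all_fingroup cyclic.

Set Implicit Arguments.
Unset Strict Implicit.
Unset Printing Implicit Defensive.

Section Bruhat.

Variables (gT : finGroupType) (S : {set gT}).
Implicit Types u v w : gT.

(* Least k such that w is a product of k elements of S ((S ^+ k)%g is the
   pointwise product of k copies of S).  Every w in <<S>> is such a product for
   some k < #|gT|: the prefixes of a shortest word are pairwise distinct. *)
Definition cox_length w : nat :=
  find (fun k => w \in (S ^+ k)%g) (iota 0 #|gT|).

Definition reflections : {set gT} := class_support S <<S>>.

Definition bruhat_step u v : bool :=
  [exists t in reflections, v == (u * t)%g] && (cox_length u < cox_length v).

Definition bruhat_le : rel gT := connect bruhat_step.

Definition bruhat_lt u v : bool := (u != v) && bruhat_le u v.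

End Bruhat.

(* The Weyl group of type B_n as the group of signed permutations: it acts on
   'I_n * bool, where (k, false) and (k, true) stand for k + 1 and -(k + 1).
   Simple reflections are numbered from 0, so [simple_refl i] is s_(i+1): for
   i + 1 < n it exchanges consecutive letters of the same sign, and the last one
   changes a sign. *)
Section TypeB.

Variable n : nat.

Definition signed_perm : finGroupType := {perm 'I_n * bool}.

Definition simple_refl (i : 'I_n) : signed_perm :=
  if i.+1 < n
  then (tperm (i, false) (ordS i, false) * tperm (i, true) (ordS i, true))%g
  else tperm (i, false) (i, true).

Definition simple_refls : {set signed_perm} := [set simple_refl i | i : 'I_n].

Definition weylB : {group signed_perm} := <<simple_refls>>%G.

Definition weylB_lt : rel signed_perm := bruhat_lt simple_refls.

Lemma ordS_neq (i : 'I_n) : i.+1 < n -> (ordS i == i) = false.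
Proof.
by move=> lt_in; rewrite -val_eqE /= modn_small // eqn_leq ltnn.
Qed.

Lemma simple_reflE (i k : 'I_n) (b : bool) :
  simple_refl i (k, b) =
    if i.+1 < n then (if k == i then ordS i else if k == ordS i then i else k, b)
    else (k, b (+) (k == i)).
Proof.
rewrite /simple_refl; case: ifP => [lt_in | _].
  have ni := ordS_neq lt_in.
  have swap c : tperm (i, c) (ordS i, c) (k, c) =
                  (if k == i then ordS i else if k == ordS i then i else k, c).
    case: tpermP => [[->]|[->]|]; rewrite ?eqxx ?ni // => nki nkSi.
    case: eqP => [ki|_]; first by case: nki; rewrite ki.
    by case: eqP => [kSi|_] //; case: nkSi; rewrite kSi.
  rewrite permM; case: b; last first.
    by rewrite swap tpermD // xpair_eqE andbF.
  by rewrite (@tpermD _ (i, false)) ?swap // xpair_eqE andbF.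
case: tpermP => [[-> ->]|[-> ->]|]; rewrite ?eqxx //.
move=> nkf nkt; case: eqP => [ki|_]; last by rewrite addbF.
by rewrite ki in nkf nkt; case: b nkf nkt.
Qed.

Lemma simple_refl_sq (i : 'I_n) : (simple_refl i * simple_refl i = 1)%g.
Proof.
apply/permP=> -[k b]; rewrite permM perm1 (simple_reflE i k).
case: ifP => lt_in; rewrite simple_reflE lt_in; last first.
  by rewrite -addbA addbb addbF.
have ni := ordS_neq lt_in.
case: (k =P i) => [->|/eqP/negPf ki]; first by rewrite ni eqxx.
by case: (k =P ordS i) => [->|/eqP/negPf kSi]; rewrite ?eqxx // ki kSi.
Qed.

Lemma ordS_eq (i j : 'I_n) : i.+1 = j :> nat -> ordS i = j.
Proof. by move=> ij; apply: val_inj; rewrite /= ij modn_small. Qed.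

Lemma simple_refl_commute (i j : 'I_n) :
  i.+1 < j -> commute (simple_refl i) (simple_refl j).
Proof.
move=> lt_ij; apply/permP=> -[k b].
have lt_in : i.+1 < n by apply: ltn_trans (ltn_ord j).
rewrite /commute !permM (simple_reflE i k) (simple_reflE j k) lt_in.
have Si : ordS i = i.+1 :> nat by rewrite /= modn_small.
have ne (a c : 'I_n) : a < c -> ((a == c) = false) * ((c == a) = false).
  by move=> lt_ac; rewrite -!val_eqE /= eq_sym gtn_eqF.
have iSi : i < ordS i by rewrite Si.
have Sij : ordS i < j by rewrite Si.
have ij := ltn_trans iSi Sij.
case lt_jn: (j.+1 < n); rewrite !simple_reflE lt_in lt_jn; last first.
  congr (_, _ (+) _).
  case: (k =P i) => [->|_]; first by rewrite !(ne _ _ Sij, ne _ _ ij).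
  by case: (k =P ordS i) => [->|_] //; rewrite !(ne _ _ Sij, ne _ _ ij).
have jSj : j < ordS j by rewrite /= modn_small.
have iSj := ltn_trans ij jSj; have SiSj := ltn_trans Sij jSj.
pose E := (eqxx, ne _ _ iSi, ne _ _ Sij, ne _ _ ij, ne _ _ jSj, ne _ _ iSj,
  ne _ _ SiSj).
congr (_, _).
case: (k =P i) => [ki|/eqP/negPf ki]; first by rewrite ?ki !E.
case: (k =P ordS i) => [kSi|/eqP/negPf kSi]; first by rewrite ?kSi !E.
case: (k =P j) => [kj|/eqP/negPf kj]; first by rewrite ?kj !E.
case: (k =P ordS j) => [kSj|/eqP/negPf kSj]; first by rewrite ?kSj !E.
by rewrite !(ki, kSi).
Qed.

Lemma simple_refl_order3 (i j : 'I_n) : i.+1 = j :> nat -> j.+1 < n ->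
  #[simple_refl i * simple_refl j]%g = 3.
Proof.
move=> ij lt_jn; have lt_in : i.+1 < n by rewrite ij.
have Sij := ordS_eq ij.
have ne (a c : 'I_n) : a < c -> ((a == c) = false) * ((c == a) = false).
  by move=> lt_ac; rewrite -!val_eqE /= eq_sym gtn_eqF.
have ltij : i < j by rewrite -ij.
have jSj : j < ordS j by rewrite /= modn_small.
have iSj := ltn_trans ltij jSj.
pose E := (eqxx, ne _ _ ltij, ne _ _ jSj, ne _ _ iSj).
apply/prime_nt_dvdP; rewrite ?order_eq1 //; last first.
  rewrite order_dvdn; apply/eqP; apply/permP=> -[k b]; rewrite !expgS expg0 mulg1 !permM perm1.
  rewrite !(simple_reflE, lt_in, lt_jn, Sij); congr (_, _).
  case: (k =P i) => [ki|/eqP/negPf ki]; first by rewrite ?ki !E.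
  case: (k =P j) => [kj|/eqP/negPf kj]; first by rewrite ?kj !E.
  case: (k =P ordS j) => [kSj|/eqP/negPf kSj]; first by rewrite ?kSj !E.
  by rewrite !(ki, kj, kSj).
apply/eqP=> /permP/(_ (i, false)); rewrite permM perm1.
rewrite !(simple_reflE, lt_in, lt_jn, Sij) !E => /(congr1 fst) Sji.
by move: (iSj); rewrite [ordS j]Sji ltnn.
Qed.

Lemma simple_refl_order4 (i j : 'I_n) : i.+1 = j :> nat -> j.+1 = n ->
  #[simple_refl i * simple_refl j]%g = 4.
Proof.
move=> ij jn; have lt_in : i.+1 < n by rewrite ij.
have lt_jn : j.+1 < n = false by rewrite jn ltnn.
have Sij := ordS_eq ij.
have nij : ((i == j) = false) * ((j == i) = false).
  by rewrite -!val_eqE /= -ij eqn_leq ltnn andbF eqn_leq ltnn.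
set x := (_ * _)%g.
have xE k b : x (k, b) =
    (if k == i then j else if k == j then i else k, b (+) (k == i)).
  rewrite /x permM simple_reflE lt_in simple_reflE lt_jn Sij.
  by congr (_, _ (+) _); do 2?[case: (k =P _) => ?]; rewrite ?eqxx ?nij //; apply/eqP.
clearbody x.
have x4 : (x ^+ 4 = 1)%g.
  apply/permP=> -[k b]; rewrite !expgS expg0 mulg1 !permM perm1 !xE.
  case: (k =P i) => [->|/eqP/negPf ki].
    by rewrite !(eqxx, nij); case: b.
  case: (k =P j) => [->|/eqP/negPf kj].
    by rewrite !(eqxx, nij); case: b.
  by rewrite !(ki, kj, addbF).
have nx2 : (x ^+ 2 != 1)%g.
  apply/eqP=> /permP/(_ (i, false)); rewrite expgS expg1 permM perm1 !xE.
  by rewrite !(eqxx, nij).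
have : #[x]%g %| 2 ^ 2 by rewrite order_dvdn x4.
case/(dvdn_pfactor _ _ (isT : prime 2)) => [[|[|[|m]]]] // _ ox.
  by rewrite -order_dvdn ox in nx2.
by rewrite -order_dvdn ox in nx2.
Qed.

End TypeB.

(* Rows and columns are numbered from 0: the box (r, c), with 1 <= r <= n and
   1 <= c <= n - r + 1, is encoded as (r - 1, c - 1), and its label s_(r+c-1) as
   the index r + c - 2. *)
Section Diagrams.

Variable n : nat.

Definition box : finType := {b : 'I_n * 'I_n | b.1 + b.2 < n}.

Definition row (b : box) : nat := (val b).1.
Definition col (b : box) : nat := (val b).2.
Definition label (b : box) : 'I_n := Ordinal (valP b).

Definition box_cover : rel box := fun a b =>
  (row b == row a) && (col b == (col a).+1)
  || (row a == (row b).+1) && (col b == col a).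

Definition box_le : rel box := connect box_cover.

Definition linear_extension (e : #|box|.-tuple box) : Prop :=
  uniq e /\ (forall i j, box_le (tnth e i) (tnth e j) -> i <= j).

(* true stands for +, and false for 0 *)
Definition oplus_diagram : finType := {ffun box -> bool}.

Section ReadingOrder.

Variable e : #|box|.-tuple box.

(* The letter at (0-based) position t of the word is the label of the box
   b_(m-t), i.e. the word is read from the end of the linear extension. *)
Definition read_box (t : 'I_#|box|) : box := tnth e (rev_ord t).

Definition letter (t : 'I_#|box|) : signed_perm n :=
  simple_refl (label (read_box t)).

Definition factor (D : oplus_diagram) (t : 'I_#|box|) : signed_perm n :=
  if D (read_box t) then 1%g else letter t.

Definition partial_prod (D : oplus_diagram) (k : nat) : signed_perm n :=
  (\prod_(t < #|box| | t < k) factor D t)%g.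

Lemma partial_prod_weylB D k : partial_prod D k \in weylB n.
Proof.
apply: group_prod => t _; rewrite /factor; case: ifP => _; rewrite ?group1 //.
by apply: mem_gen; apply: imset_f.
Qed.

Definition is_Gamma (D : oplus_diagram) : bool :=
  [forall k : 'I_#|box|,
     weylB_lt (partial_prod D k) (partial_prod D k * letter k)%g].

Definition Gamma_diagrams : {set oplus_diagram} := [set D | is_Gamma D].

End ReadingOrder.

Lemma bottom_row_lt : 0 < n -> n.-1 < n.
Proof. by rewrite ltn_predL. Qed.

Lemma bottom_box_proof (n_gt0 : 0 < n) :
  Ordinal (bottom_row_lt n_gt0) + Ordinal n_gt0 < n.
Proof. by rewrite /= addn0 ltn_predL. Qed.

Definition bottom_box (n_gt0 : 0 < n) : box :=
  exist _ (Ordinal (bottom_row_lt n_gt0), Ordinal n_gt0)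
    (bottom_box_proof n_gt0).

Definition bottom_plus_Gamma (n_gt0 : 0 < n) (e : #|box|.-tuple box) :
    {set oplus_diagram} :=
  [set D in Gamma_diagrams e | D (bottom_box n_gt0)].

(* The letters of a preference function lie in {1, ..., k} with k <= n, so words
   of length n over 'I_n.+1 = {0, ..., n} contain all of them. *)
Definition is_preference (p : n.-tuple 'I_n.+1) : bool :=
  [exists k : 'I_n.+1, [forall a : 'I_n.+1, (a \in p) == (1 <= a <= k)]].

Definition preference_functions : {set n.-tuple 'I_n.+1} :=
  [set p | is_preference p].

End Diagrams.

Arguments linear_extension {n} e.
Arguments Gamma_diagrams {n} e.
Arguments bottom_plus_Gamma {n} n_gt0 e.

(* Main.v *)
Require Import Defs.
From mathcomp Require Import all_boot all_fingroup zify.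

Set Implicit Arguments.
Unset Strict Implicit.
Unset Printing Implicit Defensive.

(* Encode P in the Weyl group by its word of labels, the values of P^-1 at the
   positive letters, ordered 1 < ... < n < -n < ... < -1.  Then P < P s_i means
   that the labels at i and i + 1 increase (for i = n: that the last one is
   positive), so only the labels met by a box matter; as incomparable boxes have
   commuting labels, every linear extension yields the same Gamma-diagrams, and
   we may read Q column by column, from right to left.

   A column pushes a new smallest label c through the current word x: a 0 lets
   the carried label pass, a + exchanges it with the label it meets.  A + may be
   put exactly on the rows whose label is positive and smaller than all
   later ones, the "alive" rows.  If x has a alive rows, the words obtained from
   it satisfy
     sum_w y^alive(w) = 2 y (1 + y)^a + (1 - y) y^a,
   hence p_k(y), the sum of y^alive over the words after k columns, satisfies
     p_(k+1)(y) = 2 y p_k(y + 1) + (1 - y) p_k(y).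
   With N(k, j) the number of surjections of a k-set onto a j-set, the solution is
     p_k(y) = sum_j binom(y + j - 1, j) (N(k, j) + N(k, j + 1)),
   so p_n(1) is twice the number of preference functions.  The last box read is
   the bottom one and its content is unconstrained, which gives the factor 2. *)

(** * Column insertions *)

Section Words.

Variable n : nat.

(* Labels are encoded by their rank in 1 < ... < n < -n < ... < -1, from 0 to
   2n - 1; [negr] is the change of sign. *)
Definition negr v := n.*2.-1 - v.

(* The words obtained by pushing the carried label [c] down a column whose rows
   have labels [x]; at each box the + outcome comes first, then the 0 outcome. *)
Fixpoint insertions (c : nat) (x : seq nat) : seq (seq nat) :=
  if x is h :: x' then
    if c < h then
      map (cons c) (insertions h x') ++ map (cons h) (insertions c x')
    else [::]
  else if c < n then [:: [:: c]; [:: negr c]] else [::].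

(** Ranks below [n] are the positive labels. The same condition says that a row labelled [c] above
    [x] is alive and that [c] can be pushed through [x] at all. *)
Definition small_before c x := (c < n) && all (ltn c) x.

Fixpoint alive (x : seq nat) : nat :=
  if x is h :: x' then small_before h x' + alive x' else 0.

Lemma negr_ge v : v < n -> n <= negr v.
Proof. rewrite /negr; lia. Qed.

Lemma negrK v : v < n.*2 -> negr (negr v) = v.
Proof. rewrite /negr; lia. Qed.

(** A negative label is not alive, and it exceeds every positive label, so at the end it kills no
    row. *)
Lemma alive_rcons x v : n <= v -> alive (rcons x v) = alive x.
Proof.
move=> le_nv; elim: x => [|h x IHx] /=; first by rewrite /small_before ltnNge le_nv.
rewrite IHx /small_before all_rcons /=; case: (ltnP h n) => //= lt_hn.
by rewrite (leq_trans lt_hn le_nv).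
Qed.

(** An obstruction for [c] below [h] is still met when [c] passes on. After an exchange [h] is
    carried, and since [c < h], success for [h] would imply success for [c]. *)
Lemma insertions_nil c x : ~~ small_before c x -> insertions c x = [::].
Proof.
rewrite /small_before; elim: x c => [|h x IHx] c /=; first by rewrite andbT => /negPf->.
case: ifP => //= lt_ch nok.
rewrite !IHx //; apply: contra nok => /andP[lt_hn lt_hx].
by rewrite (ltn_trans lt_ch lt_hn); apply: sub_all lt_hx => v /=; apply: ltn_trans.
Qed.

Lemma insertions_ge m c x w :
    m <= c -> m <= n -> all (leq m) x -> w \in insertions c x ->
  all (leq m) w.
Proof.
move=> + le_mn; elim: x c w => [|h x IHx] c w le_mc /=.
  case: ifP => // /negr_ge le_nc _; rewrite !inE => /orP[]/eqP-> /=; rewrite andbT //.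
  exact: leq_trans le_nc.
case/andP=> le_mh le_mx; case: ifP => // _.
by rewrite mem_cat => /orP[]/mapP[w' w'in ->] /=;
  rewrite ?le_mc ?le_mh (IHx _ _ _ _ w'in).
Qed.

(** A + at any box leaves the label carried there in its row, and [c] is carried until the first +.
    So [c] disappears only for the all-zero column, whose last box negates it. *)
Lemma insertions_avoid c x : small_before c x ->
  [seq w <- insertions c x | c \notin w] = [:: rcons x (negr c)].
Proof.
elim: x c => [|h x IHx] c; rewrite /small_before /= => /andP[lt_cn].
  move=> _; rewrite lt_cn /= !inE eqxx /= ifT //.
  by rewrite ltn_eqF // (leq_trans lt_cn (negr_ge lt_cn)).
case/andP=> lt_ch lt_cx; rewrite lt_ch filter_cat !filter_map.
rewrite (@eq_filter _ _ pred0) => [|w]; last by rewrite /= inE eqxx.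
rewrite filter_pred0 /= (@eq_filter _ _ (fun w => c \notin w)) => [|w]; last first.
  by rewrite /= inE (ltn_eqF lt_ch).
by rewrite IHx // /small_before lt_cn.
Qed.

Lemma sum_insertions_split c x y : small_before c x ->
  \sum_(w <- insertions c x) y ^ alive w =
    \sum_(w <- insertions c x | c \in w) y ^ alive w + y ^ alive x.
Proof.
move=> ok; rewrite (bigID (fun w => c \in w)) /=; congr addn.
rewrite -big_filter insertions_avoid // big_seq1 alive_rcons // negr_ge //.
by case/andP: ok.
Qed.

(** Restricting to words that still contain [c] makes the induction close. If [c] is exchanged with
    [h], it stays on top of larger labels, is alive, and contributes a factor [y]. If [c] passes,
    the smaller label [c] ends below [h], so row [h] is dead and contributes nothing. *)
Lemma sum_insertions_mem c x y : small_before c x ->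
  \sum_(w <- insertions c x | c \in w) y ^ alive w + y ^ (alive x).+1 =
    2 * y * y.+1 ^ alive x.
Proof.
elim: x c => [|h x IHx] c; rewrite /small_before /= => /andP[lt_cn].
  move=> _; rewrite lt_cn !big_cons big_nil !inE eqxx /=.
  rewrite ltn_eqF ?(leq_trans lt_cn (negr_ge lt_cn)) //.
  by rewrite /small_before lt_cn expn1 expn0; lia.
case/andP=> lt_ch lt_cx; rewrite lt_ch big_cat !big_map /=.
have -> : \sum_(w <- insertions h x | c \in c :: w)
     y ^ (small_before c w + alive w) = y * \sum_(w <- insertions h x) y ^ alive w.
  rewrite big_distrr /= big_seq_cond [RHS]big_seq.
  apply: congr_big => // w; first by rewrite inE eqxx andbT.
  case/andP=> w_in _; rewrite /small_before lt_cn.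
  by rewrite (insertions_ge _ _ _ w_in) // expnS.
have -> : \sum_(w <- insertions c x | c \in h :: w)
     y ^ (small_before h w + alive w) =
   \sum_(w <- insertions c x | c \in w) y ^ alive w.
  apply: congr_big => // w; first by rewrite inE (ltn_eqF lt_ch).
  rewrite inE (ltn_eqF lt_ch) /= => cw; rewrite /small_before.
  suff /negPf-> : ~~ all (ltn h) w by rewrite andbF.
  by apply/negP=> /allP/(_ _ cw) /=; rewrite ltnNge ltnW.
have := IHx c; rewrite /small_before lt_cn lt_cx => /(_ isT).
(* If row [h] is dead, exchanging with it leads to no word and [alive] is unchanged; if it is alive,
   both induction hypotheses apply. *)
case okh: ((h < n) && all (ltn h) x); last first.
  by rewrite (@insertions_nil h x) ?/small_before ?okh // big_nil muln0.
rewrite (sum_insertions_split _ okh).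
have := IHx h okh; rewrite !add1n !expnS.
set s1 := \sum_(_ <- insertions h x | _) _; set s2 := \sum_(_ <- insertions c x | _) _.
by move: (y ^ _) (y.+1 ^ _) => u v; nia.
Qed.

Lemma sum_insertions c x y : small_before c x ->
  \sum_(w <- insertions c x) y ^ alive w + y * y ^ alive x =
    2 * y * y.+1 ^ alive x + y ^ alive x.
Proof.
move=> ok; rewrite sum_insertions_split //.
by rewrite -(sum_insertions_mem y ok) expnS addnAC.
Qed.

(** Only the last [k] labels are recorded: the first [n - k] are still in their initial order and
    smaller than all others. *)
Fixpoint column_words k : seq (seq nat) :=
  if k is k'.+1 then flatten [seq insertions (n - k) x | x <- column_words k']
  else [:: [::]].

Lemma column_words_ge k w : k <= n -> w \in column_words k -> all (leq (n - k)) w.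
Proof.
elim: k w => [|k IHk] w lt_kn /=; first by rewrite inE => /eqP->.
case/flattenP=> _ /mapP[x x_in ->]; apply: insertions_ge => //; first lia.
by apply: sub_all (IHk x (ltnW lt_kn) x_in) => v /=; lia.
Qed.

Definition alive_poly k y := \sum_(w <- column_words k) y ^ alive w.

Lemma alive_polyS k y : k < n ->
  alive_poly k.+1 y + y * alive_poly k y =
    2 * y * alive_poly k y.+1 + alive_poly k y.
Proof.
move=> lt_kn; rewrite /alive_poly /= big_flatten big_map /= !big_distrr /=.
rewrite -!big_split /= !big_seq; apply: eq_bigr => x x_in.
apply: sum_insertions; rewrite /small_before; apply/andP; split; first lia.
by apply: sub_all (column_words_ge (ltnW lt_kn) x_in) => v /=; lia.
Qed.

End Words.

(** * Surjections and preference functions *)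

(* Number of surjections from an m-set onto a k-set. *)
Fixpoint surj m k :=
  match m, k with
  | 0, 0 => 1
  | m'.+1, k'.+1 => k * (surj m' k' + surj m' k)
  | _, _ => 0
  end.

Lemma surj_small m k : m < k -> surj m k = 0.
Proof.
elim: m k => [|m IHm] [|k] //= lt_mk.
by rewrite !IHm ?muln0 // ltnW.
Qed.

Definition surj2 m k := surj m k + surj m k.+1.

Lemma surj2S m k : surj2 m.+1 k.+1 = k.+1 * surj2 m k + k.+2 * surj2 m k.+1.
Proof. by []. Qed.

(** The claimed closed form at [y = z + 1]; this shift turns the binomial of [y + k - 1] over [k]
    into ['C(z + k, k)] without subtraction. *)
Definition surj_poly m z := \sum_(k < m.+1) 'C(z + k, k) * surj2 m k.

Lemma surj_polyS m z :
  surj_poly m.+1 z + z.+1 * surj_poly m z =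
    2 * z.+1 * surj_poly m z.+1 + surj_poly m z.
Proof.
rewrite /surj_poly big_ord_recl /=.
under eq_bigr => i _ do rewrite /bump /= add1n surj2S mulnDr.
rewrite big_split /= addnCA.
(* Shift the index of the second half of the recursion; the new top term vanishes because
   [surj2 m m.+1 = 0]. *)
have -> : 'C(z + 0, 0) * surj2 m.+1 0 +
   \sum_(i < m.+1) 'C(z + i.+1, i.+1) * (i.+2 * surj2 m i.+1) =
   \sum_(k < m.+1) 'C(z + k, k) * (k.+1 * surj2 m k).
  have s0 : surj2 m m.+1 = 0 by rewrite /surj2 !surj_small.
  have h0 : surj2 m.+1 0 = surj2 m 0 by rewrite /surj2 /= mul1n.
  rewrite big_ord_recr /= s0 !muln0 !addn0 !bin0 mul1n h0.
  rewrite [RHS]big_ord_recl /= addn0 bin0 !mul1n; congr addn.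
rewrite !big_distrr /= -!big_split /=; apply: eq_bigr => k _.
(* It remains to compare the coefficients of [surj2 m k]; all binomials are reduced to multiples of
   ['C(z + k, k)]. *)
have e1 := mul_bin_diag (z + k).+1 k; have e2 := mul_bin_down (z + k).+1 k.
have e3 : (z + k).+1 - k = z.+1 by lia.
rewrite e3 /= in e2; rewrite /= in e1; rewrite addnS addSn.
move: ('C(_, k.+1)) ('C((z + k).+1, k)) ('C(z + k, k)) (surj2 m k) e1 e2.
move=> a b c s e1 e2.
have {}e1 : (z + k).+1 * c * s = k.+1 * a * s by rewrite e1.
have {}e2 : (z + k).+1 * c * s = z.+1 * b * s by rewrite e2.
nia.
Qed.

Lemma alive_poly_surj n k z : k <= n -> alive_poly n k z.+1 = surj_poly k z.
Proof.
elim: k z => [|k IHk] z lt_kn.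
  by rewrite /alive_poly /surj_poly /= big_seq1 big_ord1 addn0 bin0.
have := alive_polyS z.+1 lt_kn; rewrite !IHk ?(ltnW lt_kn) // -surj_polyS.
exact: addIn.
Qed.

(** All binomials become 1, and both halves of [surj2] give the full sum because [surj m 0] and
    [surj m m.+1] vanish; the former uses [0 < m]. *)
Lemma surj_poly0 m : 0 < m -> surj_poly m 0 = 2 * \sum_(k < m.+1) surj m k.
Proof.
move=> m_gt0; rewrite /surj_poly.
under eq_bigr => k _ do rewrite add0n binn mul1n /surj2.
rewrite big_split /= mul2n -addnn; congr addn.
rewrite big_ord_recr [RHS]big_ord_recl /= surj_small // addn0.
by case: m m_gt0.
Qed.

(** * Tuples with a prescribed set of letters *)

Section TuplesWithSupport.

Variable T : finType.

(** Fix the head [x] in [A]: the tail uses either all of [A] or [A] without [x], which is the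
    recursion of [surj]. *)
Lemma card_tuples_support m (A : {set T}) :
  #|[set p : m.-tuple T | [set x in p] == A]| = surj m #|A|.
Proof.
elim: m A => [|m IHm] A.
  case: (set_0Vmem A) => [->|[x xA]]; rewrite ?cards0 /=.
    apply/eqP/cards1P; exists [tuple]; apply/setP=> p; rewrite !inE tuple0 eqxx.
    by apply/eqP/setP=> x; rewrite !inE.
  rewrite (cardsD1 x) xA /=; apply: eq_card0 => p; rewrite !inE tuple0.
  by apply/negP=> /eqP/setP/(_ x); rewrite xA !inE.
pose B x := [set p : m.-tuple T | ([set y in p] == A) || ([set y in p] == A :\ x)].
have cardB x : x \in A -> #|B x| = surj m #|A|.-1 + surj m #|A|.
  move=> xA; have -> : B x = [set p : m.-tuple T | [set y in p] == A]
      :|: [set p : m.-tuple T | [set y in p] == A :\ x].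
    by apply/setP=> p; rewrite !inE.
  rewrite cardsU !IHm (cardsD1 x A) xA /= (_ : _ :&: _ = set0) ?cards0 ?subn0 1?addnC //.
  apply/setP=> p; rewrite !inE; apply/negP=> /andP[/eqP-> /eqP/setP/(_ x)].
  by rewrite !inE eqxx xA.
rewrite -sum1_card (partition_big (fun p => thead p) (mem A)) /=; last first.
  by move=> p; rewrite inE => /eqP <-; rewrite inE mem_tnth.
rewrite (eq_bigr (fun=> surj m #|A|.-1 + surj m #|A|)) => [|x xA]; last first.
  rewrite -(cardB x xA) sum1dep_card.
  have cons_inj : injective (fun p : m.-tuple T => [tuple of x :: p]).
    by move=> p q /(congr1 val) /= [] /val_inj.
  rewrite -(card_imset _ cons_inj); apply: eq_card => p.
  case/tupleP: p => y q; rewrite !inE theadE; apply/andP/imsetP => [[/eqP pA /eqP yx]|].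
    exists q; last by rewrite yx.
    rewrite -yx inE; case yq: (y \in q); apply/orP; [left | right]; apply/eqP/setP=> z;
      rewrite -pA !inE; case: eqP => //= ->; rewrite yq //.
  case=> q' qB /(congr1 val) /= [] -> /val_inj ->; split=> //; apply/eqP/setP=> z.
  move: qB; rewrite !inE => /orP[]/eqP/setP/(_ z); rewrite !inE => ->;
    by case: eqP => //= ->; rewrite ?xA.
by rewrite sum_nat_const; case: #|A|.
Qed.

End TuplesWithSupport.

(** * Lengths in type B *)

(** [cox_length] only searches below the group order, here the factorial of [2n]; this places the
    length bound [n ^ 2] inside that range. *)
Lemma sqr_lt_fact m : m ^ 2 < m.*2`!.
Proof.
case: m => // m; rewrite doubleS !factS mulnA.
by have := fact_gt0 m.*2; move: (_`!) => u; nia.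
Qed.

Section WordLength.

Variable n : nat.

(* In ranks, the positive roots e_i - e_j, e_i + e_j (i < j) and e_i are inverted
   when x_j < x_i, 2n <= x_i + x_j and n <= x_i respectively. *)
Definition root_inversions h v : nat := (v < h) + (n.*2 <= h + v).

Fixpoint word_length (x : seq nat) : nat :=
  if x is h :: x' then
    (n <= h) + \sum_(v <- x') root_inversions h v + word_length x'
  else 0.

(** The inversion of the root [e_i + e_j] is symmetric in the two labels, so only the root
    [e_i - e_j] of the exchanged pair changes status. *)
Lemma word_length_swap pre a b post : a < b ->
  word_length (pre ++ b :: a :: post) = (word_length (pre ++ a :: b :: post)).+1.
Proof.
move=> lt_ab; elim: pre => [|h pre IHpre] /=.
  rewrite !big_cons {1 4}/root_inversions lt_ab ltnNge (ltnW lt_ab) /=.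
  by rewrite (addnC b a); lia.
rewrite IHpre addnS; congr (_ + _ + _).+1; apply: perm_big.
by rewrite perm_cat2l -[b :: a :: post]/([:: b] ++ [:: a] ++ post) perm_catCA.
Qed.

(** For each earlier label the two conditions in [root_inversions] are interchanged by [negr], so
    only the root of the last position itself changes status. *)
Lemma word_length_neg pre a : a < n ->
  word_length (rcons pre (negr n a)) = (word_length (rcons pre a)).+1.
Proof.
move=> lt_an; elim: pre => [|h pre IHpre] /=.
  by rewrite !big_nil negr_ge // leqNgt lt_an.
rewrite IHpre addnS -!cats1 !big_cat !big_seq1 /=; congr (_ + (_ + _) + _).+1.
by rewrite /root_inversions /negr; lia.
Qed.

Lemma word_length_le x : word_length x <= size x ^ 2.
Proof.
elim: x => //= h x IHx.
have le2 : \sum_(v <- x) root_inversions h v <= 2 * size x.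
  rewrite -sum1_size big_distrr /= leq_sum // => v _; rewrite /root_inversions; lia.
by move: le2 IHx; move: (\sum_(_ <- _) _) (word_length x) => u v; nia.
Qed.

End WordLength.

(** * Words of signed permutations, Coxeter length and Bruhat order *)

Section Labels.

Variable n : nat.
Implicit Types (P : signed_perm n) (i j : nat) (x : seq nat).

Definition rank (a : 'I_n * bool) : nat := if a.2 then negr n a.1 else a.1.

Definition flip (a : 'I_n * bool) : 'I_n * bool := (a.1, ~~ a.2).

Lemma rank_inj : injective rank.
Proof.
move=> [i b] [j c]; rewrite /rank /negr /=; have := ltn_ord i; have := ltn_ord j.
by case: b; case: c => lt_j lt_i eq_ij; congr (_, _); try apply: val_inj; rewrite /=; lia.
Qed.

Lemma rank_lt a : rank a < n.*2.
Proof. by rewrite /rank /negr; have := ltn_ord a.1; case: ifP => _; lia. Qed.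

Lemma rank_flip a : rank (flip a) = negr n (rank a).
Proof.
by case: a => k [] //=; rewrite /rank /negr /=; have := ltn_ord k; lia.
Qed.

(* [simple_refl] with a [nat] index, extended by 1 beyond the range. *)
Definition sr i : signed_perm n :=
  if insub i is Some k then simple_refl (k : 'I_n) else 1%g.

Lemma sr_ord (k : 'I_n) : sr k = simple_refl k.
Proof. by rewrite /sr valK. Qed.

Lemma srK i : (sr i * sr i = 1)%g.
Proof. by rewrite /sr; case: insubP => [k _ _|_]; rewrite ?simple_refl_sq ?mulg1. Qed.

Lemma sr_weylB i : sr i \in weylB n.
Proof.
rewrite /sr; case: insubP => [k _ _|_]; last exact: group1.
by apply: mem_gen; apply: imset_f.
Qed.

Lemma sr_commute i j : i.+1 < j -> commute (sr i) (sr j).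
Proof.
move=> lt_ij; rewrite /sr; case: insubP => [k _ ki|_]; last exact: commute_sym (commute1 _).
case: insubP => [l _ lj|_]; last exact: commute1.
by apply: simple_refl_commute; rewrite ki lj.
Qed.

Lemma sr_flip i a : sr i (flip a) = flip (sr i a).
Proof.
rewrite /sr; case: insubP => [k _ _|_]; last by rewrite !perm1.
case: a => l b; rewrite /flip !simple_reflE /=; case: ifP => //= _.
by rewrite addNb.
Qed.

Lemma weylB_flip P a : P \in weylB n -> P (flip a) = flip (P a).
Proof.
case/gen_prodgP=> m [c c_in ->]; elim: m c c_in a => [|m IHm] c c_in a.
  by rewrite big_ord0 !perm1.
rewrite big_ord_recl !permM -IHm => [|k]; last exact: c_in.
by case/imsetP: (c_in ord0) => k _ ->; rewrite -sr_ord sr_flip.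
Qed.

(* With mathcomp's convention [(P * s) a = s (P a)], it is the inverse of P whose
   values at positions i and i + 1 are exchanged by right multiplication by s_i. *)
Definition word P : seq nat :=
  [seq rank (P^-1%g (i, false)) | i : 'I_n <- enum 'I_n].

Lemma size_word P : size (word P) = n.
Proof. by rewrite size_map size_enum_ord. Qed.

Lemma nth_word P (i : 'I_n) : nth 0 (word P) i = rank (P^-1%g (i, false)).
Proof. by rewrite (nth_map i) ?size_enum_ord // nth_ord_enum. Qed.

Lemma word1 : word 1 = iota 0 n.
Proof.
rewrite -val_enum_ord; apply: eq_map => i /=.
by rewrite invg1 perm1.
Qed.

Lemma srV i : ((sr i)^-1 = sr i)%g.
Proof. by apply/eqP; rewrite eq_invg_mul srK. Qed.

Lemma nth_word_swap P i j : i.+1 < n -> j < n ->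
  nth 0 (word (P * sr i)) j =
    nth 0 (word P) (if j == i then i.+1 else if j == i.+1 then i else j).
Proof.
move=> lt_in lt_jn; have lt_i := ltnW lt_in.
pose i' := Ordinal lt_i; pose j' := Ordinal lt_jn.
have Si : ordS i' = i.+1 :> nat by rewrite /= modn_small.
rewrite (nth_word _ j') invMg srV permM (sr_ord i') simple_reflE lt_in -nth_word.
congr nth; rewrite -!val_eqE -[val (ordS i')]/(ordS i' : nat) Si /=.
by case: ifP => _; [rewrite /= modn_small | case: ifP].
Qed.

Lemma nth_word_last P i j : P \in weylB n -> i.+1 = n -> j < n ->
  nth 0 (word (P * sr i)) j =
    if j == i then negr n (nth 0 (word P) j) else nth 0 (word P) j.
Proof.
move=> PW in_ lt_jn; have lt_i : i < n by rewrite -in_.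
pose i' := Ordinal lt_i; pose j' := Ordinal lt_jn.
rewrite !(nth_word _ j') invMg srV permM (sr_ord i') simple_reflE.
rewrite [i'.+1]in_ ltnn -val_eqE /=.
case: ifP => _ //; rewrite -[(_, _)]/(flip (j', false)) weylB_flip ?groupV //.
exact: rank_flip.
Qed.

Lemma nth_word_far P i j : P \in weylB n -> i < n -> j < n -> i != j -> i.+1 != j ->
  nth 0 (word (P * sr i)) j = nth 0 (word P) j.
Proof.
move=> PW lt_in lt_jn nij nSij.
case: (ltnP i.+1 n) => [lt_Sin | le_nSi].
  by rewrite nth_word_swap // eq_sym (negPf nij) eq_sym (negPf nSij).
by rewrite nth_word_last // 1?eq_sym ?(negPf nij) //; lia.
Qed.

Lemma word_swap P pre a b post : word P = pre ++ a :: b :: post ->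
  word (P * sr (size pre)) = pre ++ b :: a :: post.
Proof.
move=> wP; have sz : size pre + (size post).+2 = n by rewrite -(size_word P) wP size_cat.
apply: (@eq_from_nth _ 0) => [|j]; rewrite size_word ?size_cat //= => lt_jn.
rewrite nth_word_swap // ?wP; last by lia.
rewrite !nth_cat; case: eqP => [->|]; first by rewrite ltnn subnn ltnNge leqnSn subSnn.
case: eqP => [-> _|]; first by rewrite ltnn subnn ltnNge leqnSn subSnn.
by case: ltnP => // le_j; case: (j - size pre) (subnKC le_j) => [|[|k]] /=; lia.
Qed.

Lemma word_neg P pre a : P \in weylB n -> word P = rcons pre a ->
  word (P * sr (size pre)) = rcons pre (negr n a).
Proof.
move=> PW wP; have sz : (size pre).+1 = n by rewrite -(size_word P) wP size_rcons.
apply: (@eq_from_nth _ 0) => [|j]; rewrite size_word ?size_rcons //= => lt_jn.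
rewrite nth_word_last // wP !nth_rcons; case: eqP => [->|_] //.
by rewrite ltnn.
Qed.

Definition asc P i :=
  if i.+1 < n then nth 0 (word P) i < nth 0 (word P) i.+1
  else nth 0 (word P) i < n.

Lemma asc_swap P pre a b post : word P = pre ++ a :: b :: post ->
  asc P (size pre) = (a < b).
Proof.
move=> wP; rewrite /asc ifT; last first.
  by rewrite -[X in _ < X](size_word P) wP size_cat /=; lia.
by rewrite wP !nth_cat ltnn subnn [(size pre).+1 < _]ltnNge leqnSn subSnn.
Qed.

Lemma asc_last P pre a : word P = rcons pre a -> asc P (size pre) = (a < n).
Proof.
move=> wP; rewrite /asc ifF; last first.
  by rewrite -[X in _ < X](size_word P) wP size_rcons ltnn.
by rewrite wP nth_rcons ltnn eqxx.
Qed.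

Lemma asc_far P i j : P \in weylB n -> i < n -> j < n ->
  (i.+1 < j) || (j.+1 < i) -> asc (P * sr i) j = asc P j.
Proof.
move=> PW lt_in lt_jn far; rewrite /asc.
by case: ifP => lt_Sj; rewrite !nth_word_far //; lia.
Qed.

Definition lenB P := word_length n (word P).

Lemma lenB1 : lenB 1 = 0.
Proof.
rewrite /lenB word1.
suff H m k : k + m <= n -> word_length n (iota k m) = 0 by exact: H.
elim: m k => //= m IHm k le_n; rewrite IHm; last by lia.
rewrite addn0 leqNgt big_seq big1 => [|v]; first by lia.
by rewrite mem_iota /root_inversions; lia.
Qed.

Lemma word_split P i : i.+1 < n ->
  exists pre a b post, word P = pre ++ a :: b :: post /\ size pre = i.
Proof.
move=> lt_in; exists (take i (word P)), (nth 0 (word P) i), (nth 0 (word P) i.+1).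
exists (drop i.+2 (word P)); split; last by rewrite size_take size_word ltnW.
by rewrite -!drop_nth ?size_word ?(ltnW lt_in) // cat_take_drop.
Qed.

Lemma word_split_last P i : i.+1 = n ->
  exists pre a, word P = rcons pre a /\ size pre = i.
Proof.
move=> in_; exists (take i (word P)), (nth 0 (word P) i).
split; last by rewrite size_take size_word -in_ ltnSn.
rewrite -[LHS](cat_take_drop i) (drop_nth 0) ?size_word -?in_ //.
by rewrite drop_oversize ?size_word ?in_ // cats1.
Qed.

Lemma word_lt P v : v \in word P -> v < n.*2.
Proof. by case/mapP=> i _ ->; apply: rank_lt. Qed.

Lemma word_uniq P : uniq (word P).
Proof.
rewrite map_inj_uniq ?enum_uniq // => i j /rank_inj/perm_inj.
by case.
Qed.

Lemma lenB_sr P i : P \in weylB n -> i < n ->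
  if asc P i then lenB (P * sr i) = (lenB P).+1 else lenB P = (lenB (P * sr i)).+1.
Proof.
move=> PW lt_in; rewrite /lenB; case: (ltnP i.+1 n) => [lt_Sin | le_n].
  have [pre [a [b [post [wP <-]]]]] := word_split P lt_Sin.
  rewrite (asc_swap wP) (word_swap wP) wP; case: ltngtP => [lt_ab|lt_ba|eq_ab].
  - exact: word_length_swap.
  - exact: word_length_swap.
  have := word_uniq P; rewrite wP eq_ab cat_uniq /= inE eqxx /=.
  by rewrite !andbF.
have in_ : i.+1 = n by lia.
have [pre [a [wP <-]]] := word_split_last P in_.
rewrite (asc_last wP) (word_neg PW wP) wP; case: ltnP => [lt_an | le_na].
  exact: word_length_neg.
have lt_a : a < n.*2 by apply: (@word_lt P); rewrite wP mem_rcons mem_head.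
rewrite -{1}(negrK lt_a) word_length_neg // /negr; lia.
Qed.

(** Without descents the word increases and ends with a positive label, so all its labels are
    positive and it is the identity word. *)
Lemma asc_all1 P : P \in weylB n -> (forall i, i < n -> asc P i) -> P = 1%g.
Proof.
move=> PW ascP.
have so : sorted ltn (word P).
  apply/(sortedP 0) => i; rewrite size_word => lt_in.
  by have := ascP _ (ltnW lt_in); rewrite /asc lt_in.
have small v : v \in word P -> v < n.
  move=> v_in; have n_gt0 : 0 < n by rewrite -(size_word P); case: (word P) v_in.
  have in_ : n.-1.+1 = n by lia.
  have [pre [a [wP sz]]] := word_split_last P in_.
  have := ascP n.-1; rewrite -sz (asc_last wP) => lt_an.
  have {}lt_an : a < n by apply: lt_an; lia.
  move: v_in; rewrite wP mem_rcons inE => /predU1P[-> //| v_pre].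
  apply: ltn_trans lt_an; move: so.
  rewrite wP -cats1 (sorted_pairwise ltn_trans).
  by rewrite pairwise_cat allrel1r => /andP[/allP/(_ _ v_pre)].
have wP : word P = iota 0 n.
  apply: (irr_sorted_eq ltn_trans ltnn) => //; first exact: iota_ltn_sorted.
  have sub : {subset word P <= iota 0 n} by move=> v /small; rewrite mem_iota.
  by have [] := uniq_min_size (word_uniq P) sub; rewrite ?size_word ?size_iota.
apply: invg_inj; rewrite invg1; apply/permP=> a; rewrite perm1.
have fixf (i : 'I_n) : P^-1%g (i, false) = (i, false).
  by apply: rank_inj; rewrite -nth_word wP nth_iota // ltn_ord.
case: a => i [|//]; rewrite -[(i, true)]/(flip (i, false)) weylB_flip ?groupV //.
by rewrite fixf.
Qed.

Lemma descent_exists P : P \in weylB n -> P != 1%g ->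
  exists2 i, i < n & ~~ asc P i.
Proof.
move=> PW nP1; case: (boolP [forall i : 'I_n, asc P i]) => [/forallP ascP|].
  case/eqP: nP1; apply: asc_all1 => // i lt_in; exact: (ascP (Ordinal lt_in)).
by rewrite negb_forall => /existsP[i ni]; exists i.
Qed.

Lemma mem_simple_refls Q : Q \in simple_refls n -> exists2 i, i < n & Q = sr i.
Proof. by case/imsetP=> i _ ->; exists i; rewrite ?sr_ord. Qed.

Lemma sr_simple i : i < n -> sr i \in simple_refls n.
Proof. by move=> lt_in; rewrite (sr_ord (Ordinal lt_in)) imset_f. Qed.

Lemma lenB_le P k : P \in (simple_refls n ^+ k)%g -> P \in weylB n /\ lenB P <= k.
Proof.
elim: k P => [|k IHk] P.
  by rewrite expg0 => /set1P->; rewrite lenB1 group1.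
rewrite expgSr => /mulsgP[Q _ /IHk[QW le_Q] /mem_simple_refls[i lt_in ->] ->].
split; first by rewrite groupM ?sr_weylB.
have := lenB_sr QW lt_in; case: ifP => _ lQ; first by rewrite lQ.
by apply: leqW; apply: leq_trans le_Q; rewrite lQ.
Qed.

(** A nontrivial element has a descent, which splits off one simple reflection and lowers [lenB] by
    one. *)
Lemma mem_exp_lenB P : P \in weylB n -> P \in (simple_refls n ^+ lenB P)%g.
Proof.
move: {2}(lenB P) (erefl (lenB P)) => k; elim: k P => [|k IHk] P lP PW.
  rewrite lP expg0; apply/set1P/eqP; apply: contraT => /(descent_exists PW)[i lt_in ni].
  by have := lenB_sr PW lt_in; rewrite (negPf ni); lia.
have /(descent_exists PW)[i lt_in ni] : P != 1%g.
  by apply/eqP=> P1; rewrite P1 lenB1 in lP.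
have := lenB_sr PW lt_in; rewrite (negPf ni) lP => -[lQ].
have QW : (P * sr i)%g \in weylB n by rewrite groupM ?sr_weylB.
rewrite expgSr -[P]mulg1 -(srK i) mulgA mem_mulg ?sr_simple //.
by rewrite lQ; apply: IHk.
Qed.

Lemma cox_lengthE P : P \in weylB n -> cox_length (simple_refls n) P = lenB P.
Proof.
move=> PW; rewrite /cox_length.
have card_gt : lenB P < #|signed_perm n|.
  have -> : #|signed_perm n| = n.*2`!.
    rewrite -[in RHS](_ : #|[set: 'I_n * bool]| = n.*2); last first.
      by rewrite cardsT card_prod card_ord card_bool muln2.
    by rewrite -card_perm; apply: eq_card => Q; rewrite !inE; symmetry; apply/subsetP=> a.
  apply: leq_ltn_trans (sqr_lt_fact n).
  by rewrite -[in X in _ <= X](size_word P) word_length_le.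
apply/eqP; rewrite eqn_leq; apply/andP; split.
  rewrite leqNgt; apply/negP=> /(before_find 0).
  by rewrite nth_iota // add0n mem_exp_lenB.
have hasP : has (fun k => P \in (simple_refls n ^+ k)%g) (iota 0 #|signed_perm n|).
  by apply/hasP; exists (lenB P); rewrite ?mem_iota ?mem_exp_lenB.
have := nth_find 0 hasP; have := hasP; rewrite has_find size_iota => lt_f.
by rewrite nth_iota // => /lenB_le[].
Qed.

(** An ascent is a single Bruhat step. At a descent the length drops, whereas it grows along every
    Bruhat chain. *)
Lemma weylB_lt_asc P i : P \in weylB n -> i < n ->
  weylB_lt P (P * sr i)%g = asc P i.
Proof.
move=> PW lt_in; have QW : (P * sr i)%g \in weylB n by rewrite groupM ?sr_weylB.
have := lenB_sr PW lt_in; case: ifP => ascP lenP; last first.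
  apply/negP=> /andP[nPQ /connectP[p]].
  have : forall R, path (bruhat_step (simple_refls n)) R p ->
      cox_length (simple_refls n) R <= cox_length (simple_refls n) (last R p).
    elim: p => //= Q p IHp R /andP[/andP[_ lt_RQ] /IHp]; exact/leq_trans/ltnW.
  move=> mono /mono + lastp; rewrite -lastp !cox_lengthE // lenP.
  by rewrite ltnn.
apply/andP; split; first by apply/eqP=> PQ; move: lenP; rewrite -PQ; lia.
apply: connect1; rewrite /bruhat_step !cox_lengthE // lenP ltnSn andbT.
apply/existsP; exists (sr i); rewrite eqxx andbT.
apply/imset2P; exists (sr i) 1%g; rewrite ?conjg1 ?group1 //; exact: sr_simple.
Qed.

End Labels.

(** * Independence of the linear extension *)

Definition plab (p : nat * nat) := p.1 + p.2.

Definition ple : rel (nat * nat) := fun p q => (q.1 <= p.1) && (p.2 <= q.2).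

Definition reading (s : seq (nat * nat)) := pairwise (fun p q => ~~ ple p q) s.

Lemma ple_refl p : ple p p.
Proof. by rewrite /ple !leqnn. Qed.

Lemma ple_trans : transitive ple.
Proof. by move=> q p r; rewrite /ple; lia. Qed.

(** Of two incomparable boxes, one has both a larger row and a larger column, so their labels differ
    by at least 2. *)
Lemma incomparable_far p q : ~~ ple p q -> ~~ ple q p ->
  ((plab p).+1 < plab q) || ((plab q).+1 < plab p).
Proof. rewrite /ple /plab; lia. Qed.

Section Reading.

Variables (n : nat) (D : nat * nat -> bool).
Implicit Types (s t : seq (nat * nat)) (b p q : nat * nat).

Definition pos_factor p : signed_perm n := if D p then 1%g else sr n (plab p).

Definition pos_prod s : signed_perm n := (\prod_(p <- s) pos_factor p)%g.

Lemma pos_prod_weylB s : pos_prod s \in weylB n.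
Proof.
apply: group_prod => p _; rewrite /pos_factor; case: ifP => _; first exact: group1.
exact: sr_weylB.
Qed.

Lemma pos_factor_commute p q : ~~ ple p q -> ~~ ple q p ->
  commute (pos_factor p) (pos_factor q).
Proof.
move=> npq nqp; rewrite /pos_factor; case: ifP => _; first exact: commute_sym (commute1 _).
case: ifP => _; first exact: commute1.
by case/orP: (incomparable_far npq nqp) => /(@sr_commute n) // /commute_sym.
Qed.

(** Let [p] be last in [s]. The boxes after [p] in [t] are incomparable with it, so its factor
    commutes past them to the end. *)
Lemma pos_prod_perm s t : reading s -> reading t -> perm_eq s t -> pos_prod s = pos_prod t.
Proof.
elim/last_ind: s t => [|s p IHs] t rs rt pst.
  by rewrite perm_sym in pst; rewrite (perm_nilP pst).
have p_t : p \in t by rewrite -(perm_mem pst) mem_rcons mem_head.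
case/splitPr: p_t rt pst => t1 t2 rt pst.
have {}pst : perm_eq s (t1 ++ t2).
  move: pst; rewrite perm_rcons perm_sym -[p :: t2]cat1s perm_catCA /= perm_cons.
  by rewrite perm_sym.
move: rs; rewrite /reading -cats1 pairwise_cat allrel1r => /and3P[nsp rs _].
move: rt; rewrite /reading pairwise_cat allrel_consr /=.
case/and3P=> /andP[_ r12] r1 /andP[npt r2].
have rt : reading (t1 ++ t2) by rewrite /reading pairwise_cat r12 r1.
rewrite /pos_prod big_cat big_seq1 /= -/(pos_prod s) (IHs _ rs rt pst) /pos_prod.
rewrite !big_cat big_cons /= -mulgA; congr (_ * _)%g; symmetry.
rewrite big_seq; apply: commute_prod => q q_t2; apply: pos_factor_commute.
  exact: (allP npt).
by apply: (allP nsp); rewrite (perm_mem pst) mem_cat q_t2 orbT.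
Qed.

(* The boxes read before [b] but not above it can be moved to the end, where they
   do not affect the labels met by [b]. *)
Lemma asc_pos_prod s b : reading (rcons s b) -> all (fun p => plab p < n) (rcons s b) ->
  asc (pos_prod s) (plab b) = asc (pos_prod (filter (ple b) s)) (plab b).
Proof.
rewrite all_rcons => + /andP[lt_b lt_s].
rewrite /reading -cats1 pairwise_cat allrel1r => /and3P[nsb rs _].
set u := filter _ s; set v := filter (predC (ple b)) s.
have -> : pos_prod s = pos_prod (u ++ v).
  apply: pos_prod_perm => //; last by rewrite perm_sym perm_filterC.
  rewrite /reading pairwise_cat !pairwise_filter // !andbT; apply/allrelP=> p q.
  rewrite !mem_filter => /andP[bp _] /andP[/= nbq _].
  by apply: contra nbq; apply: ple_trans.
have : {subset v <= s} by move=> q; rewrite mem_filter => /andP[].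
have : all (predC (ple b)) v by apply: filter_all.
elim/last_ind: v => [|v q IHv]; first by rewrite cats0.
rewrite all_rcons => /andP[/= nbq nbv] sub; have q_s := sub q.
rewrite mem_rcons mem_head in q_s; rewrite -rcons_cat /pos_prod -cats1 big_cat big_seq1 /=.
rewrite -/(pos_prod (u ++ v)) -IHv // => [|p p_v]; last first.
  by apply: sub; rewrite mem_rcons inE p_v orbT.
rewrite /pos_factor; case: ifP => _; first by rewrite mulg1.
apply: asc_far; rewrite ?pos_prod_weylB // ?(allP lt_s) ?q_s //.
by apply: incomparable_far => //; apply: (allP nsb); rewrite q_s.
Qed.

Fixpoint all_asc s (P : signed_perm n) :=
  if s is p :: s' then asc P (plab p) && all_asc s' (P * pos_factor p)%g else true.

Lemma all_ascP s P :
  reflect (forall s1 b s2, s = s1 ++ b :: s2 -> asc (P * pos_prod s1)%g (plab b))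
    (all_asc s P).
Proof.
elim: s P => [|p s IHs] P /=.
  by apply: (iffP idP) => // _ [].
apply: (iffP andP) => [[ascp /IHs ascs] [|p' s1] b s2 /= [<- def_s]|ascs].
- by rewrite /pos_prod big_nil mulg1.
- by rewrite /pos_prod big_cons mulgA; apply: ascs def_s.
split; first by have := ascs [::] p s erefl; rewrite /pos_prod big_nil mulg1.
apply/IHs=> s1 b s2 def_s; have := ascs (p :: s1) b s2.
by rewrite /pos_prod big_cons mulgA def_s; apply.
Qed.

(** By [asc_pos_prod] the test at [b] depends only on the boxes above [b], and these are the same
    set in both readings. *)
Lemma all_asc_perm s t : reading s -> reading t -> perm_eq s t ->
  all (fun p => plab p < n) s -> all_asc s 1 = all_asc t 1.
Proof.
wlog suff impl : s t / reading s -> reading t -> perm_eq s t ->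
    all (fun p => plab p < n) s -> all_asc s 1 -> all_asc t 1.
  move=> rs rt pst lt_s.
  have lt_t : all (fun p => plab p < n) t by rewrite -(perm_all _ pst).
  by apply/idP/idP; apply: impl => //; rewrite perm_sym.
move=> rs rt pst lt_s /all_ascP ascs; apply/all_ascP=> t1 b t2 def_t.
have b_s : b \in s by rewrite (perm_mem pst) def_t mem_cat mem_head orbT.
have lt_t : all (fun p => plab p < n) t by rewrite -(perm_all _ pst).
case/splitPr: b_s (ascs) rs pst lt_s => s1 s2 /(_ s1 b s2 erefl) + rs pst lt_s.
rewrite def_t in rt pst lt_t; rewrite !mul1g.
(* Everything above [b] is read before [b], so filtering the prefix or the whole reading gives the
   same list. *)
have above u1 u2 : reading (u1 ++ b :: u2) -> all (fun p => plab p < n) (u1 ++ b :: u2) ->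
    [/\ asc (pos_prod u1) (plab b) = asc (pos_prod (filter (ple b) u1)) (plab b),
      reading (filter (ple b) u1) &
      filter (ple b) u1 = filter (predI (ple b) (predC1 b)) (u1 ++ b :: u2)].
  rewrite -cat_rcons all_cat => ru /andP[lt_u _].
  move: ru; rewrite /reading pairwise_cat => /and3P[rbu ru1 ru2].
  split; first exact: asc_pos_prod.
    by move: ru1; rewrite -cats1 pairwise_cat => /and3P[_ ru1 _]; apply: pairwise_filter.
  rewrite filter_cat (@eq_in_filter _ _ pred0 u2) ?filter_pred0 ?cats0; last first.
    move=> q q_u2; move/allrelP: rbu => /(_ b q); rewrite mem_rcons mem_head.
    by move=> /(_ isT q_u2) /= /negPf->.
  rewrite filter_rcons /= eqxx andbF; apply: eq_in_filter => q q_u1 /=.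
  rewrite -[LHS]andbT; case: (q =P b) => [qb|] //; rewrite qb in q_u1.
  move: ru1; rewrite -cats1 pairwise_cat allrel1r => /andP[/allP/(_ _ q_u1)].
  by rewrite ple_refl.
have [-> rfs fs] := above _ _ rs lt_s; have [-> rft ft] := above _ _ rt lt_t.
rewrite (@pos_prod_perm (filter (ple b) s1) (filter (ple b) t1)) //.
by rewrite fs ft perm_filter.
Qed.

End Reading.

(** * Reading column by column *)

Section ColumnReading.

Variable n : nat.

(* true stands for +, as in [oplus_diagram] *)
Fixpoint bits_asc (w : seq nat) (bs : bitseq) (P : signed_perm n) :=
  match w, bs with
  | i :: w', d :: bs' => asc P i && bits_asc w' bs' (if d then P else P * sr n i)%g
  | _, _ => true
  end.

Lemma all_asc_bits D s (P : signed_perm n) :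
  all_asc D s P = bits_asc (map plab s) (map D s) P.
Proof.
elim: s P => //= p s IHs P; rewrite IHs /pos_factor; congr (_ && bits_asc _ _ _).
by case: ifP => _; rewrite ?mulg1.
Qed.

Fixpoint all_bits k : seq bitseq :=
  if k is k'.+1 then map (cons true) (all_bits k') ++ map (cons false) (all_bits k')
  else [:: [::]].

Lemma mem_all_bits k bs : (bs \in all_bits k) = (size bs == k).
Proof.
elim: k bs => [|k IHk] [|b bs] //=; rewrite mem_cat.
  by apply/orP=> -[]/mapP[].
rewrite eqSS -IHk; apply/orP/idP => [[]/mapP[bs' bs'_in [_ ->]] //|bs_in].
by case: b; [left | right]; apply: map_f.
Qed.

Lemma all_bits_uniq k : uniq (all_bits k).
Proof.
elim: k => //= k IHk; rewrite cat_uniq !map_inj_uniq ?IHk /= ?andbT; try by move=> ? ? [].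
by apply/hasPn=> _ /mapP[bs _ ->]; apply/mapP=> -[].
Qed.

(** Final products over all admissible fillings, with multiplicity; a failed ascent test discards
    the branch. *)
Fixpoint outcomes (w : seq nat) (P : signed_perm n) : seq (signed_perm n) :=
  if w is i :: w' then
    if asc P i then outcomes w' P ++ outcomes w' (P * sr n i)%g else [::]
  else [:: P].

Lemma size_outcomes w P :
  size (outcomes w P) = count (fun bs => bits_asc w bs P) (all_bits (size w)).
Proof.
elim: w P => //= i w IHw P; rewrite count_cat !count_map /=.
case: ifP => ascP /=; last first.
  by rewrite !(@eq_count _ _ pred0) ?count_pred0 // => bs /=; rewrite ascP.
by rewrite size_cat !IHw; congr addn; apply: eq_count => bs /=; rewrite ascP.
Qed.

Lemma outcomes_cat w w' P :
  outcomes (w ++ w') P = flatten [seq outcomes w' Q | Q <- outcomes w P].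
Proof.
elim: w P => [|i w IHw] P /=; first by rewrite cats0.
by case: ifP => // _; rewrite !IHw map_cat flatten_cat.
Qed.

Lemma outcomes_weylB w P Q : P \in weylB n -> Q \in outcomes w P -> Q \in weylB n.
Proof.
elim: w P => [|i w IHw] P PW /=; first by rewrite inE => /eqP->.
by case: ifP => // _; rewrite mem_cat => /orP[]; apply: IHw; rewrite // groupM ?sr_weylB.
Qed.

(** Labels of boxes increase by one down a column, so each box tests the carried label against the
    next one. The label left behind is final and joins [pre]. *)
Lemma outcomes_column (P : signed_perm n) pre c x :
    P \in weylB n -> word P = pre ++ c :: x ->
  map (@word n) (outcomes (iota (size pre) (size x).+1) P) =
    map (cat pre) (insertions n c x).
Proof.
elim: x P pre c => [|h x IHx] P pre c PW wP.
  rewrite cats1 in wP; rewrite /= (asc_last wP); case: ifP => //= _.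
  by rewrite wP (word_neg PW wP) !cats1.
rewrite [insertions _ _ _]/= [iota _ _]/= [outcomes _ _]/= (asc_swap wP).
case: ifP => // _; rewrite !map_cat -!map_comp.
have PsW : (P * sr n (size pre))%g \in weylB n by rewrite groupM ?sr_weylB.
have := IHx P (rcons pre c) h PW; have := IHx _ (rcons pre h) c PsW.
rewrite !size_rcons !cat_rcons => -> //; last exact: word_swap.
by move=> -> //; congr cat; apply: eq_map => w /=; rewrite cat_rcons.
Qed.

Fixpoint column_reading k : seq (nat * nat) :=
  if k is k'.+1 then
    column_reading k' ++ [seq (r, n - k) | r <- iota 0 k]
  else [::].

Lemma column_readingS k :
  column_reading k.+1 =
    column_reading k ++ [seq (r, n - k.+1) | r <- iota 0 k.+1].
Proof. by []. Qed.

Lemma mem_column_reading k p : k <= n ->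
  (p \in column_reading k) = (n - k <= p.2) && (plab p < n).
Proof.
case: p => r c; elim: k => [|k IHk] lt_kn; first by rewrite in_nil /plab /=; lia.
rewrite column_readingS mem_cat IHk ?(ltnW lt_kn) //.
have -> : ((r, c) \in [seq (r, n - k.+1) | r <- iota 0 k.+1]) =
    (c == n - k.+1) && (r < k.+1).
  apply/mapP/andP => [[r' + [-> ->]] | [/eqP-> lt_r]].
    by rewrite mem_iota.
  by exists r; rewrite ?mem_iota.
by rewrite /plab /=; lia.
Qed.

Lemma column_reading_reading k : k <= n -> reading (column_reading k).
Proof.
elim: k => // k IHk lt_kn; rewrite column_readingS /reading pairwise_cat.
apply/and3P; split; last 2 first.
- exact/IHk/ltnW.
- rewrite pairwise_map; have := iota_ltn_sorted 0 k.+1.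
  rewrite (sorted_pairwise ltn_trans); apply: sub_pairwise => r r' /=; rewrite /ple /=; lia.
apply/allrelP=> p _ p_in /mapP[r _ ->]; move: p_in.
by rewrite mem_column_reading ?(ltnW lt_kn) // /ple /=; lia.
Qed.

Lemma outcomes_column_reading k : k <= n ->
  map (@word n) (outcomes (map plab (column_reading k)) 1%g) =
    map (cat (iota 0 (n - k))) (column_words n k).
Proof.
elim: k => [|k IHk] lt_kn; first by rewrite /= word1 subn0 cats0.
have {}IHk := IHk (ltnW lt_kn).
rewrite column_readingS map_cat outcomes_cat -map_comp.
rewrite (@eq_map _ _ _ (fun r => (n - k.+1) + r)) => [|r]; last by rewrite /plab /= addnC.
rewrite -iotaDl addn0.
(* [g] is the effect of one column on full words: [drop] removes the untouched labels before the
   insertion. *)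
pose g w := map (cat (iota 0 (n - k.+1))) (insertions n (n - k.+1) (drop (n - k) w)).
have gE Q : Q \in outcomes (map plab (column_reading k)) 1%g ->
    map (@word n) (outcomes (iota (n - k.+1) k.+1) Q) = g (word Q).
  move=> Q_in; have QW := outcomes_weylB (group1 _) Q_in.
  have /mapP[x _ wQ] : word Q \in map (cat (iota 0 (n - k))) (column_words n k).
    by rewrite -IHk map_f.
  have szx : size x = k.
    have := size_word Q; rewrite wQ size_cat size_iota => /(canRL (addKn _)) ->.
    by rewrite subKn // ltnW.
  rewrite /g wQ drop_size_cat ?size_iota //.
  (* The label pushed next is the last of the untouched ones. *)
  have def_pre : iota 0 (n - k) = rcons (iota 0 (n - k.+1)) (n - k.+1).
    by rewrite -cats1 (_ : n - k = n - k.+1 + 1) ?iotaD //; lia.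
  rewrite def_pre cat_rcons in wQ.
  by have := outcomes_column QW wQ; rewrite size_iota szx.
rewrite map_flatten -map_comp.
have /eq_in_map-> := gE : {in _, _ =1 g \o @word n}.
rewrite map_comp IHk -map_comp /= map_flatten -map_comp; congr flatten.
apply: eq_map => x /=; by rewrite /g drop_size_cat ?size_iota.
Qed.

Lemma size_outcomes_column_reading :
  size (outcomes (map plab (column_reading n)) 1%g) = alive_poly n n 1.
Proof.
rewrite -(size_map (@word n)) outcomes_column_reading // size_map -sum1_size.
by apply: eq_bigr => x _; rewrite exp1n.
Qed.

End ColumnReading.

(** * Counting *)

Section PreferenceFunctions.

Variable n : nat.

Lemma card_initial_interval (k : 'I_n.+1) : #|[set a : 'I_n.+1 | 1 <= a <= k]| = k.
Proof.
have card_le : #|[set a : 'I_n.+1 | a < k.+1]| = k.+1.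
  rewrite -sum1dep_card (big_ord_narrow (ltn_ord k : k.+1 <= n.+1)) /=.
  by rewrite sum1_card card_ord.
have := cardsD1 ord0 [set a : 'I_n.+1 | a < k.+1]; rewrite card_le inE /= add1n => -[] def_k.
rewrite [RHS]def_k.
by apply: eq_card => a; rewrite !inE -val_eqE /= lt0n ltnS.
Qed.

Lemma card_preference_functions :
  #|preference_functions n| = \sum_(k < n.+1) surj n k.
Proof.
rewrite -sum1_card.
(* For a preference function the largest letter equals the number of distinct letters. *)
pose max_letter (p : n.-tuple 'I_n.+1) : 'I_n.+1 := inord #|[set a in p]|.
rewrite (partition_big max_letter predT) //= /max_letter.
apply: eq_bigr => k _; rewrite sum1dep_card -[in RHS](card_initial_interval k).
rewrite -card_tuples_support; apply: eq_card => p; rewrite !inE.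
apply/andP/eqP => [[/existsP[l /forallP supp_p]] | supp_p].
  have -> : [set a in p] = [set a : 'I_n.+1 | 1 <= a <= l].
    by apply/setP=> a; rewrite !inE (eqP (supp_p a)).
  by rewrite card_initial_interval inord_val => /eqP->.
rewrite supp_p card_initial_interval inord_val; split=> //.
apply/existsP; exists k; apply/forallP=> a.
by move/setP/(_ a): supp_p; rewrite !inE => ->.
Qed.

End PreferenceFunctions.

(** * From diagrams and linear extensions to column readings *)

Section Boxes.

Variable n : nat.
Implicit Types (a b : box n) (D : oplus_diagram n).

Definition bpos b : nat * nat := (row b, col b).

Lemma bpos_inj : injective bpos.
Proof.
move=> a b [/val_inj eq_r /val_inj eq_c]; apply: val_inj.
by rewrite [LHS]surjective_pairing eq_r eq_c -surjective_pairing.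
Qed.

Lemma bpos_lt b : plab (bpos b) < n.
Proof. exact: valP b. Qed.

Lemma bpos_surj p : plab p < n -> exists b, bpos b = p.
Proof.
case: p => r c; rewrite /plab /= => lt_rc.
have lt_r : r < n by lia.
have lt_c : c < n by lia.
by exists (exist _ (Ordinal lt_r, Ordinal lt_c) lt_rc).
Qed.

(** Climb to the row of [b] first and then move right: in this order the path stays inside [Q]. *)
Lemma ple_box_le a b : ple (bpos a) (bpos b) -> box_le a b.
Proof.
move: {2}(_ + _) (leqnn (row a - row b + (col b - col a))) => m.
elim: m a => [|m IHm] a; rewrite /ple /= => le_m /andP[le_r le_c].
  by have -> : a = b; [apply: bpos_inj; congr (_, _); lia | apply: connect0].
case: (ltnP (row b) (row a)) => [lt_r | le_ar].
  have [a' [ra' ca']] : exists a', bpos a' = ((row a).-1, col a).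
    by apply: bpos_surj; have := bpos_lt a; rewrite /plab /=; lia.
  apply: connect_trans (connect1 _) (IHm a' _ _); rewrite /box_cover /ple /= ra' ca' //.
  - by rewrite eqxx andbT orbC prednK ?eqxx //; lia.
  - by lia.
  by rewrite le_c andbT; lia.
have eq_r : row a = row b by apply/eqP; rewrite eqn_leq le_ar.
case: (ltnP (col a) (col b)) => [lt_c | le_cb]; last first.
  by have -> : a = b; [apply: bpos_inj; congr (_, _); lia | apply: connect0].
have [a' [ra' ca']] : exists a', bpos a' = (row a, (col a).+1).
  by apply: bpos_surj; have := bpos_lt b; rewrite /plab /= eq_r; lia.
apply: connect_trans (connect1 _) (IHm a' _ _); rewrite /box_cover /ple /= ra' ca' //.
- by rewrite !eqxx.
- by lia.
by rewrite le_r.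
Qed.

Lemma bottom_ple (n_gt0 : 0 < n) b : ple (bpos (bottom_box n_gt0)) (bpos b).
Proof. by rewrite /ple /= andbT -ltnS prednK // ltn_ord. Qed.

Definition at_pos D (p : nat * nat) : bool := [exists b, (bpos b == p) && D b].

Lemma at_posE D b : at_pos D (bpos b) = D b.
Proof.
apply/existsP/idP => [[a /andP[/eqP/bpos_inj-> //]] | Db].
by exists b; rewrite eqxx.
Qed.

Lemma pos_factorE D b : pos_factor n (at_pos D) (bpos b) =
  if D b then 1%g else simple_refl (label b).
Proof. by rewrite /pos_factor at_posE -sr_ord. Qed.

Section LinearExtension.

Variable e : #|box n|.-tuple (box n).
Hypothesis e_lin : linear_extension e.

Let s := [seq bpos b | b <- rev e].

Let size_s : size s = #|box n|.
Proof. by rewrite size_map size_rev size_tuple. Qed.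

Lemma nth_reading (t : 'I_#|box n|) : nth (0, 0) s t = bpos (read_box e t).
Proof.
rewrite (nth_map (read_box e t)) ?size_rev ?size_tuple // nth_rev ?size_tuple //.
by rewrite {2}/read_box (tnth_nth (read_box e t)).
Qed.

Lemma extension_reading : reading s.
Proof.
apply/(pairwiseP (0, 0)) => i j; rewrite !inE size_s => lt_i lt_j lt_ij.
rewrite (nth_reading (Ordinal lt_i)) (nth_reading (Ordinal lt_j)).
apply/negP=> /ple_box_le/(e_lin.2) /=.
by rewrite leqNgt ltn_sub2l // (leq_ltn_trans lt_ij lt_j).
Qed.

Lemma extension_perm : perm_eq s (column_reading n n).
Proof.
have uniq_reading u : reading u -> uniq u.
  by apply: pairwise_uniq => p; rewrite ple_refl.
apply: uniq_perm => [||p].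
- exact/uniq_reading/extension_reading.
- exact/uniq_reading/column_reading_reading.
rewrite mem_column_reading // subnn /=; apply/mapP/idP => [[b _ ->]|].
  exact: bpos_lt.
case/bpos_surj=> b <-; exists b; rewrite ?mem_rev //.
(* [e] has as many entries as there are boxes and no repetition, so it contains every box. *)
have [//||_ ->] := @uniq_min_size _ e (enum (box n)) e_lin.1; rewrite ?mem_enum //.
- by move=> a _; rewrite mem_enum.
by rewrite -cardE size_tuple.
Qed.

Lemma partial_prodE D (k : 'I_#|box n|) :
  partial_prod e D k = pos_prod n (at_pos D) (take k s).
Proof.
rewrite /partial_prod (big_ord_narrow (ltnW (ltn_ord k))).
rewrite /pos_prod (big_nth (0, 0)) big_mkord.
rewrite size_take size_s ltn_ord; apply: eq_bigr => t _.
have lt_t : t < #|box n| by apply: ltn_trans (ltn_ord k).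
rewrite nth_take // (nth_reading (Ordinal lt_t)) pos_factorE.
by congr (factor e D _); apply: val_inj.
Qed.

Lemma is_GammaE D :
  is_Gamma e D =
    all_asc (at_pos D) (column_reading n n) (1%g : signed_perm n).
Proof.
have lt_s : all (fun p => plab p < n) s.
  by apply/allP=> _ /mapP[b _ ->]; apply: bpos_lt.
have cr_reading := column_reading_reading (leqnn n).
rewrite -(all_asc_perm _ extension_reading cr_reading extension_perm lt_s).
have stepE (k : 'I_#|box n|) :
    weylB_lt (partial_prod e D k) (partial_prod e D k * letter e k)%g =
      asc (pos_prod n (at_pos D) (take k s)) (plab (nth (0, 0) s k)).
  rewrite partial_prodE nth_reading /letter -sr_ord weylB_lt_asc ?pos_prod_weylB //.
apply/forallP/all_ascP => [ascs s1 b s2 def_s | ascs k].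
  have lt_k : size s1 < #|box n| by rewrite -size_s def_s size_cat /=; lia.
  have := ascs (Ordinal lt_k); rewrite stepE /= def_s take_size_cat // nth_cat ltnn subnn.
  by rewrite mul1g.
rewrite stepE; have := ascs (take k s) (nth (0, 0) s k) (drop k.+1 s).
by rewrite mul1g; apply; rewrite -drop_nth ?size_s // cat_take_drop.
Qed.

End LinearExtension.

(** Diagrams correspond to bit sequences along the column reading, so the admissible ones are
    counted by [outcomes]. *)
Lemma card_Gamma_diagrams (e : #|box n|.-tuple (box n)) : linear_extension e ->
  #|Gamma_diagrams e| = alive_poly n n 1.
Proof.
move=> e_lin; pose cr := column_reading n n.
have cr_uniq : uniq cr.
  apply: pairwise_uniq (column_reading_reading (leqnn n)) => p.
  by rewrite ple_refl.
have cr_mem p : (p \in cr) = (plab p < n) by rewrite mem_column_reading // subnn.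
pose bits D := [seq at_pos D p | p <- cr].
have bits_inj : injective bits.
  move=> D D' /eq_in_map eqD; apply/ffunP=> b.
  by rewrite -!at_posE eqD // cr_mem bpos_lt.
have bits_perm : perm_eq (map bits (enum (oplus_diagram n))) (all_bits (size cr)).
  apply: uniq_perm; rewrite ?all_bits_uniq ?map_inj_uniq -?enumT ?enum_uniq // => bs.
  rewrite mem_all_bits; apply/mapP/eqP => [[D _ ->] | sz]; first exact: size_map.
  pose D : oplus_diagram n := [ffun b => nth false bs (index (bpos b) cr)].
  exists D; first by rewrite mem_enum.
  apply: (@eq_from_nth _ false); rewrite ?size_map // sz => i lt_i.
  have /bpos_surj[b def_b] : plab (nth (0, 0) cr i) < n by rewrite -cr_mem mem_nth.
  by rewrite (nth_map (0, 0)) // -def_b at_posE ffunE def_b index_uniq.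
rewrite -size_outcomes_column_reading size_outcomes size_map.
rewrite -(seq.permP bits_perm) count_map.
rewrite cardE {1}/enum_mem size_filter enumT; apply: eq_count => D.
by rewrite /= [D \in _]inE is_GammaE // all_asc_bits.
Qed.

(** Toggling the bottom box is an involution that preserves Gamma-diagrams: this box is read last,
    so its content enters none of the tested products. *)
Lemma card_bottom_plus_Gamma (n_gt0 : 0 < n) (e : #|box n|.-tuple (box n)) :
  linear_extension e -> #|Gamma_diagrams e| = 2 * #|bottom_plus_Gamma n_gt0 e|.
Proof.
move=> e_lin; pose b0 := bottom_box n_gt0.
pose toggle (D : oplus_diagram n) : oplus_diagram n := [ffun b => D b (+) (b == b0)].
have toggleK : involutive toggle.
  by move=> D; apply/ffunP=> b; rewrite !ffunE -addbA addbb addbF.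
have toggle_Gamma D : is_Gamma e (toggle D) = is_Gamma e D.
  apply: eq_forallb => k; suff -> : partial_prod e (toggle D) k = partial_prod e D k by [].
  apply: eq_bigr => t lt_tk; rewrite /factor ffunE.
  case: (_ =P b0) => [read_t|]; rewrite ?addbF //.
  (* The bottom box lies below every box, hence comes first in [e] and cannot be read before step
     [k]. *)
  have : box_le (tnth e (rev_ord t)) (tnth e (rev_ord k)).
    by rewrite -/(read_box e t) read_t; apply/ple_box_le/bottom_ple.
  by move/(e_lin.2); rewrite /= leqNgt ltn_sub2l // (leq_ltn_trans lt_tk (ltn_ord k)).
rewrite mul2n -addnn -(cardsID [set D : oplus_diagram n | D b0]); congr addn.
  by apply: eq_card => D; rewrite !inE.
rewrite -(card_imset _ (inv_inj toggleK)); apply: eq_card => D.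
rewrite -[D]toggleK (mem_imset _ _ (inv_inj toggleK)) !inE !toggle_Gamma.
by rewrite !ffunE eqxx !addbT negbK andbC.
Qed.

End Boxes.

Theorem mainTheorem16 (n : nat) (n_gt0 : 0 < n)
    (e : #|box n|.-tuple (box n)) (e_lin : linear_extension e) :
  (exists f : {D : oplus_diagram n | D \in bottom_plus_Gamma n_gt0 e} ->
              {p : n.-tuple 'I_n.+1 | p \in preference_functions n},
     bijective f)
  /\ #|Gamma_diagrams e| = 2 * #|preference_functions n|.
Proof.
have cardG : #|Gamma_diagrams e| = 2 * #|preference_functions n|.
  rewrite card_Gamma_diagrams // alive_poly_surj // surj_poly0 //.
  by rewrite card_preference_functions.
split=> //; have := cardG; rewrite (card_bottom_plus_Gamma n_gt0 e_lin) => /eqP.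
rewrite eqn_pmul2l // => /eqP eq_card.
have eq_sig : #|{: {D : oplus_diagram n | D \in bottom_plus_Gamma n_gt0 e}}| =
    #|{: {p : n.-tuple 'I_n.+1 | p \in preference_functions n}}|.
  by rewrite !card_sig.
(* With equal cardinalities, elements of equal rank in the two enumerations are matched. *)
exists (fun D => enum_val (cast_ord eq_sig (enum_rank D))).
exists (fun p => enum_val (cast_ord (esym eq_sig) (enum_rank p))) => x.
  by rewrite enum_valK cast_ordK enum_rankK.
by rewrite enum_valK cast_ordKV enum_rankK.
Qed.
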